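(* Under the short-run fairness objective, no online algorithm can be more than $0.942$-competitive on the class of instances consisting of a single offline agent with capacity $b=1$ eligible to serve every online type, and online types with total arrival rate $\lambda=\sum_j\lambda_j=1$.
   Context: Model: online agents of each type $j$ (finite set $J$) arrive by independent Poisson processes of constant rate $\lambda_j>0$ on $[0,1]$; on arrival the type is revealed and an online algorithm (possibly randomized and adaptive, knowing all parameters) must immediately and irrevocably serve it with the offline agent (if capacity remains) or reject it. A clairvoyant algorithm knows the realized arrivals in advance and assigns (possibly randomly) subject to the capacity constraint. Protected groups: a family $\mathcal G$ of subsets of $J$ covering $J$. Let $A_j$ be the number of type-$j$ arrivals, $\mathcal A=(A_j)_j$, $A(G)=\sum_{j\in G}A_j$, $X(G)$ the number of served agents with type in $G$. Short-run fairness: $\mathbb E_{\mathcal A}\big[\min_{G:A(G)>0}\mathbb E_{\mathrm{ALG}}[X(G)\mid\mathcal A]/A(G)\big]$, inner expectation over the algorithm's randomness, with the minimum taken to be $1$ if no agents arrive. An algorithm is $c$-competitive on a class if its objective is at least $c$ times the optimal clairvoyant objective on every instance of the class. *)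

(* Defs.v *)
From HB Require Import structures.
From mathcomp Require Import all_boot all_order all_algebra.
From mathcomp Require Import all_classical all_reals all_analysis.
Import Order.TTheory GRing.Theory Num.Theory.
Import numFieldNormedType.Exports.

Set Implicit Arguments.
Unset Strict Implicit.
Unset Printing Implicit Defensive.

Local Open Scope classical_set_scope.
Local Open Scope ring_scope.

(* A single offline agent, of the given capacity, who is eligible to serve
   every online type. *)
Record instance (R : realType) := Instance {
  online_type : finType;
  rate : online_type -> R;
  rate_gt0 : forall j, 0 < rate j;
  capacity : nat;
  groups : {set {set online_type}};
  groups_cover : finset.cover groups = [set: online_type]%SET }.

(* Events determined by the path of N on [0, t]. *)
Definition path_events (R : realType) (T : Type) (N : R -> T -> nat) (t : R)
    : set (set T) :=
  <<s [set E | exists u k, 0 <= u <= t /\ E = [set w | N u w = k]] >>.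

(* Events determined by all the paths N j, j in J, on [0, t]. *)
Definition history (R : realType) (J T : Type) (N : J -> R -> T -> nat) (t : R)
    : set (set T) :=
  <<s \bigcup_(j in [set: J]) path_events (N j) t >>.

(* A homogeneous Poisson process of rate r on the time interval [0, 1], given
   by its counting process: N t w arrivals have occurred up to and including
   time t. The last axiom expresses both the independence of the increments and
   their Poisson distribution. *)
Record poisson_process (R : realType) (d : measure_display)
    (T : measurableType d) (P : probability T R) (r : R) (N : R -> T -> nat)
    : Prop := PoissonProcess {
  poisson_measurable : forall t, 0 <= t <= 1 -> measurable_fun setT (N t);
  poisson_start : forall w, N 0 w = 0%N;
  poisson_nondecreasing : forall w s t,
    0 <= s -> s <= t -> t <= 1 -> (N s w <= N t w)%N;
  poisson_right_continuous : forall w t, 0 <= t -> t < 1 ->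
    \forall s \near t^'+, N s w = N t w;
  poisson_increments : forall (n : nat) (t : nat -> R) (k : nat -> nat),
    0 <= t 0%N -> t n <= 1 -> (forall i, (i < n)%N -> t i < t i.+1) ->
    P [set w | forall i, (i < n)%N -> (N (t i.+1) w - N (t i) w)%N = k i] =
    (\prod_(i < n) poisson_pmf (r * (t i.+1 - t i)) (k i))%:E }.

(* Mutual independence of the processes N j (subfamilies are covered by taking
   E j = setT). *)
Definition independent_processes (R : realType) (J : finType)
    (d : measure_display) (T : measurableType d) (P : probability T R)
    (N : J -> R -> T -> nat) : Prop :=
  forall E : J -> set T, (forall j, path_events (N j) 1 (E j)) ->
    P (\bigcap_(j in [set: J]) E j) = (\prod_(j : J) P (E j))%E.

(* A probability space carrying the arrival processes of the instance. *)
Record arrivals (R : realType) (I : instance R) := Arrivals {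
  arr_display : measure_display;
  arr_space : measurableType arr_display;
  arr_prob : probability arr_space R;
  count : online_type I -> R -> arr_space -> nat;
  count_poisson : forall j, poisson_process arr_prob (rate j) (count j);
  count_independent : independent_processes arr_prob count }.

(* Events determined by the arrivals up to time t together with the private
   random seed of an algorithm. The seed has its own probability space, so it is
   independent of the arrivals. *)
Definition information (R : realType) (I : instance R) (M : arrivals I)
    (d : measure_display) (S : measurableType d) (t : R)
    : set (set (arr_space M * S)) :=
  <<s [set E | exists A B,
        [/\ history (@count R I M) t A, measurable B & E = A `*` B]] >>.

(* [cl_served j (w, s)] is the number of type-j agents who are served, for the
   arrivals w and the seed s. *)
Record clairvoyant (R : realType) (I : instance R) (M : arrivals I) :=
    Clairvoyant {
  cl_display : measure_display;
  cl_seed : measurableType cl_display;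
  cl_prob : probability cl_seed R;
  cl_served : online_type I -> arr_space M * cl_seed -> nat;
  cl_measurable : forall j k,
    @information R I M _ cl_seed 1 [set z | cl_served j z = k];
  cl_arrived : forall j z, (cl_served j z <= count j 1 z.1)%N;
  cl_capacity : forall z, (\sum_j cl_served j z <= capacity I)%N }.

(* [on_served j t (w, s)] is the number of type-j agents served up to and
   including time t. It depends only on the seed and on the arrivals up to
   time t. Bounding its increments by those of the arrival count, over every
   time interval, means that an agent can be served only at the very moment of
   arrival; monotonicity means that no service is revoked. *)
Record online (R : realType) (I : instance R) (M : arrivals I) := Online {
  on_display : measure_display;
  on_seed : measurableType on_display;
  on_prob : probability on_seed R;
  on_served : online_type I -> R -> arr_space M * on_seed -> nat;
  on_adapted : forall j t k, 0 <= t <= 1 ->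
    @information R I M _ on_seed t [set z | on_served j t z = k];
  on_start : forall j z, on_served j 0 z = 0%N;
  on_nondecreasing : forall j s t z, 0 <= s -> s <= t -> t <= 1 ->
    (on_served j s z <= on_served j t z)%N;
  on_arrived : forall j s t z, 0 <= s -> s <= t -> t <= 1 ->
    (on_served j t z - on_served j s z <= count j t z.1 - count j s z.1)%N;
  on_capacity : forall z, (\sum_j on_served j 1 z <= capacity I)%N }.

(* The short-run fairness of final service counts X, given as a function of the
   arrivals and the seed. The inner integral is the expectation over the
   algorithm's randomness for the realized arrivals w, and the outer one is the
   expectation over the arrivals. As X(G) <= A(G), the neutral element 1 of the
   minimum matters only when no agent arrives. *)
Definition short_run_fairness (R : realType) (I : instance R) (M : arrivals I)
    (d : measure_display) (S : measurableType d) (Q : probability S R)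
    (X : online_type I -> arr_space M * S -> nat) : R :=
  let A (G : {set online_type I}) (w : arr_space M) :=
    (\sum_(j in G) count j 1 w)%N in
  \int[arr_prob M]_w
    \big[Num.min/1]_(G in groups I | (0 < A G w)%N)
      ((\int[Q]_s (\sum_(j in G) X j (w, s))%N%:R) / (A G w)%:R).

Definition online_fairness (R : realType) (I : instance R) (M : arrivals I)
    (p : online M) : R :=
  short_run_fairness (on_prob p) (fun j => on_served j 1).

Definition clairvoyant_fairness (R : realType) (I : instance R)
    (M : arrivals I) (q : clairvoyant M) : R :=
  short_run_fairness (cl_prob q) (@cl_served R I M q).

Definition optimal_clairvoyant (R : realType) (I : instance R)
    (M : arrivals I) : R :=
  sup [set v | exists q : clairvoyant M, v = clairvoyant_fairness q].

(* The algorithm may use all the parameters of the instance, hence the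
   dependence of alg on I. *)
Definition competitive (R : realType) (M : forall I : instance R, arrivals I)
    (alg : forall I : instance R, online (M I)) (C : instance R -> Prop) (c : R)
    : Prop :=
  forall I, C I -> c * optimal_clairvoyant (M I) <= online_fairness (alg I).

Definition unit_instance (R : realType) (I : instance R) : Prop :=
  capacity I = 1%N /\ \sum_(j : online_type I) rate j = 1.

(* Main.v *)
(* Take n = 200 types of rate 1/n, each one forming a group. A clairvoyant
   algorithm that serves one of the K arrivals uniformly at random has fairness
   1/K, and no algorithm does better for any realization. Now relax the online
   problem: the algorithm sees all the arrivals of the first half of the horizon
   at once, and then all those of the second half. If there is exactly one arrival
   in the first half, of type i, and q is the conditional probability of having
   served it by then, the fairness is at most q when nobody arrives later and at
   most 1 - q when some other type arrives later. The arrivals of the second half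
   are independent of q, and with h = exp(-1/2) >= 1/2 the conditional mean of the
   fairness is thus at most h + O(1/n). The clairvoyant one has conditional mean
   E[1/(1+K')] with K' of law Poisson(1/2), which is at least
   h/3 + 7/12 - O(1/n). The online algorithm loses at least
   (h/2)(7/12 - 2h/3 - O(1/n)) in total, whereas E[1/K] <= 1/2 + h^2, and the ratio
   exceeds 0.058. *)
Require Import Defs.
From mathcomp Require Import all_boot all_order all_algebra.
From mathcomp Require Import all_classical all_reals all_analysis.
From mathcomp Require Import measurable_realfun.
From mathcomp Require Import zify ring lra.
Import Order.TTheory GRing.Theory Num.Theory.
Import numFieldNormedType.Exports.
Set Implicit Arguments.
Unset Strict Implicit.
Unset Printing Implicit Defensive.
Local Open Scope classical_set_scope.
Local Open Scope ring_scope.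

(** * Independence of the future increments *)

(** Dynkin's argument: the measurable events independent of [B] form a lambda-system, which contains
    the pi-system [G] and hence the sigma-algebra it generates. *)
Lemma indep_sigma (R : realType) (d : measure_display) (T : measurableType d)
    (P : probability T R) (G : set (set T)) (B : set T) :
    setI_closed G -> G `<=` measurable -> measurable B ->
    (forall A, G A -> P (A `&` B) = (P A * P B)%E) ->
  forall A, <<s G >> A -> P (A `&` B) = (P A * P B)%E.
Proof.
move=> GI Gm mB GB A sA.
suff [] : [set A | measurable A /\ P (A `&` B) = (P A * P B)%E] A by [].
apply: (lambda_system_subset GI _ _ _ sA) => //; last first.
  by move=> C GC; split; [exact: Gm|exact: GB].
apply/dynkin_lambda_system; split.
- by split; [exact: measurableT|rewrite setTI probability_setT mul1e].
- move=> C [mC CB]; split; first exact: measurableC.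
  rewrite setIC -setDE measureD//; last by rewrite ltey_eq fin_num_measure.
  by rewrite (setIC B) [X in (_ - X)%E]CB probability_setC// muleBl ?mul1e// fin_num_measure.
- move=> F tF HF.
  have mF i : measurable (F i) by have [] := HF i.
  split; first exact: bigcupT_measurable.
  rewrite setI_bigcupl measure_bigcup//; last 2 first.
    by move=> i _; exact: measurableI.
    by apply: trivIset_setIr.
  rewrite measure_bigcup// muleC -(fineK (fin_num_measure P B mB)) -nneseriesZl//.
  apply: eq_eseriesr => i _; rewrite fineK ?fin_num_measure// muleC.
  by have [_] := HF i.
Qed.

Section one_process.
Variables (R : realType) (d : measure_display) (T : measurableType d).
Variables (P : probability T R) (r : R) (N : R -> T -> nat).
Hypothesis NP : poisson_process P r N.

Lemma count_measurable (t : R) k : 0 <= t <= 1 ->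
  measurable [set w | N t w = k].
Proof.
move=> t01; have := poisson_measurable NP t01 measurableT (Y := [set k]).
by rewrite setTI; apply.
Qed.

Lemma path_events_measurable (t : R) A : t <= 1 -> path_events N t A ->
  measurable A.
Proof.
move=> t1; apply: smallest_sub; first exact: sigma_algebra_measurable.
move=> _ [u [k [/andP[u0 ut] ->]]]; apply: count_measurable.
by rewrite u0 (le_trans ut).
Qed.

Lemma path_events_count (t u : R) k : 0 <= u <= t ->
  path_events N t [set w | N u w = k].
Proof. by move=> ut; apply: sub_sigma_algebra; exists u, k. Qed.

(** A type whose measurable sets are the [path_events], so that the closure lemmas for measurable
    sets apply to them. *)
Definition path_sigma (t : R) := g_sigma_algebraType
  [set E | exists u k, 0 <= u <= t /\ E = [set w | N u w = k]].

Lemma path_events_increment (s t : R) k : 0 <= s -> s <= t ->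
  path_events N t [set w | (N t w - N s w)%N = k].
Proof.
move=> s0 st.
rewrite (_ : [set _ | _] = \bigcup_m
    ([set w | N s w = m] `&` \bigcup_n
      ([set w | N t w = n] `&` [set w | (n - m)%N = k]))); last first.
  apply/seteqP; split => [w Hw|w [m _ [/= <- [n _ [/= <- //]]]]].
  by exists (N s w) => //; split => //; exists (N t w).
apply: (@bigcupT_measurable _ (path_sigma t)) => m.
apply: (@measurableI _ (path_sigma t)).
  by apply: path_events_count; rewrite s0.
apply: (@bigcupT_measurable _ (path_sigma t)) => n.
apply: (@measurableI _ (path_sigma t)).
  by apply: path_events_count; rewrite lexx (le_trans s0).
have [nmk|nmk] := eqVneq (n - m)%N k.
  rewrite (_ : mkset (fun=> (n - m)%N = k) = setT).
    exact: (@measurableT _ (path_sigma t)).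
  by apply/seteqP; split.
rewrite (_ : mkset (fun=> (n - m)%N = k) = set0).
  exact: (@measurable0 _ (path_sigma t)).
by apply/seteqP; split => // w /eqP; rewrite (negbTE nmk).
Qed.

Lemma increment_prob (s t : R) k : 0 <= s -> s < t -> t <= 1 ->
  P [set w | (N t w - N s w)%N = k] = (poisson_pmf (r * (t - s)) k)%:E.
Proof.
move=> s0 st t1.
have := poisson_increments NP (n := 1)
  (t := fun i => if i is 0 then s else t) (fun=> k) s0 t1.
rewrite big_ord_recl big_ord0 mulr1 /= => <-; last by case.
congr (P _); apply/seteqP; split => [w ? [|]//|w /(_ 0)]; exact.
Qed.

Let cylinder (L : seq (R * nat)) := [set w | forall p, p \in L -> N p.1 w = p.2].

(** Sorting the observation times into a grid from 0 to [t] turns the cylinder into a condition on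
    consecutive increments. The increment from [t] to 1 extends the grid by one step and contributes
    one more factor to the product of Poisson weights. *)
Lemma cylinder_indep (t : R) k L : 0 < t -> t < 1 ->
    (forall p, p \in L -> 0 <= p.1 <= t) -> (exists v, (t, v) \in L) ->
  P (cylinder L `&` [set w | (N 1 w - N t w)%N = k]) =
  (P (cylinder L) * P [set w | (N 1 w - N t w)%N = k])%E.
Proof.
move=> t0 t1 Lt [v Lv].
(* An empty cylinder is trivial; otherwise one of its points [w0] supplies the increments to be
   prescribed. *)
have [->|/set0P[w0 Lw0]] := eqVneq (cylinder L) set0.
  by rewrite set0I measure0 mul0e.
(* Time 0 joins the grid because all paths start from 0 there, so that increments determine
   values. *)
pose s := sort <=%R (undup (0 :: map fst L)).
have s_mem u : (u \in s) = (u == 0) || (u \in map fst L).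
  by rewrite mem_sort mem_undup inE.
have s_lt : sorted <%R s by rewrite sort_lt_sorted undup_uniq.
have s_t u : u \in s -> 0 <= u <= t.
  rewrite s_mem => /orP[/eqP->|/mapP[p pL ->]]; last exact: Lt.
  by rewrite lexx ltW.
have ts : t \in s by rewrite s_mem; apply/orP; right; apply/mapP; exists (t, v).
have s0 : 0 \in s by rewrite s_mem eqxx.
have s_le i j : (i <= j < size s)%N -> nth 1 s i <= nth 1 s j.
  move=> /andP[ij js]; have [->//|nij] := eqVneq i j.
  apply/ltW/(sorted_ltn_nth lt_trans 1 s_lt); rewrite ?inE//.
    exact: leq_ltn_trans js.
  by rewrite ltn_neqAle nij.
have size_s : (1 < size s)%N.
  move: s0 ts; case: s {s_mem s_lt s_t s_le} => [|a [|b s]]//=.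
  by rewrite !inE => /eqP <- /eqP t00; rewrite t00 ltxx in t0.
pose m := (size s).-1.
have sizeE : size s = m.+1 by rewrite /m prednK// (ltn_trans _ size_s).
have nth0 : nth 1 s 0 = 0.
  apply/le_anti/andP; split.
    rewrite -[leRHS](nth_index 1 s0) s_le//= index_mem s0//.
  by have /s_t/andP[] : nth 1 s 0 \in s by apply: mem_nth; rewrite sizeE.
have nthm : nth 1 s m = t.
  apply/le_anti/andP; split.
    by have /s_t/andP[] : nth 1 s m \in s by apply: mem_nth; rewrite sizeE.
  by rewrite -[leLHS](nth_index 1 ts) s_le// sizeE ltnSn -ltnS -sizeE index_mem ts.
(* The default value 1 of [nth] acts as the grid point that follows [t]. *)
have nthS : nth 1 s m.+1 = 1 by rewrite nth_default// sizeE.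
have nth_t i : (i <= m)%N -> 0 <= nth 1 s i <= t.
  by move=> im; apply/s_t/mem_nth; rewrite sizeE.
have lt_nth i : (i < m.+1)%N -> nth 1 s i < nth 1 s i.+1.
  rewrite ltnS leq_eqVlt => /orP[/eqP->|im]; first by rewrite nthm nthS.
  by apply: (sorted_ltn_nth lt_trans 1 s_lt) => //; rewrite inE sizeE ltnS// ltnW.
pose incr i w := (N (nth 1%R s i.+1) w - N (nth 1%R s i) w)%N.
pose kk i := if i == m then k else incr i w0.
have cylE : cylinder L = [set w | forall i, (i < m)%N -> incr i w = kk i].
  apply/seteqP; split => [w Lw i im|w Hw].
    have E u : u \in s -> N u w = N u w0.
      rewrite s_mem => /orP[/eqP->|/mapP[p pL ->]]; last by rewrite Lw// Lw0.
      by rewrite !(poisson_start NP).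
    by rewrite /kk ltn_eqF// /incr !E// mem_nth// sizeE ltnS// ltnW.
  have E i : (i <= m)%N -> N (nth 1 s i) w = N (nth 1 s i) w0.
    elim: i => [|i IH] im; first by rewrite nth0 !(poisson_start NP).
    have := Hw _ im; rewrite /kk ltn_eqF// /incr IH 1?ltnW// => Ei.
    have mono w1 : (N (nth 1%R s i) w1 <= N (nth 1%R s i.+1) w1)%N.
      have /andP[? ?] := nth_t _ (ltnW im); have /andP[? ?] := nth_t _ im.
      apply: (poisson_nondecreasing NP) => //; last by apply: le_trans (ltW t1).
      by apply/ltW/lt_nth; rewrite ltnS ltnW.
    by rewrite -(subnKC (mono w)) -(subnKC (mono w0)) IH 1?ltnW// Ei.
  move=> p pL; rewrite -(Lw0 p pL).
  have ps : p.1 \in s by rewrite s_mem map_f// orbT.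
  by rewrite -(nth_index 1 ps) E// -ltnS -sizeE index_mem.
have -> : cylinder L `&` [set w | (N 1 w - N t w)%N = k] =
    [set w | forall i, (i < m.+1)%N -> incr i w = kk i].
  rewrite cylE; apply/seteqP; split => [w [/= H1 H2] i|w /= Hw].
    rewrite ltnS leq_eqVlt => /orP[/eqP->|/H1//].
    by rewrite /incr nthm nthS /kk eqxx.
  split=> [i im|]; first by apply: Hw; rewrite ltnS ltnW.
  by have := Hw _ (ltnSn m); rewrite /incr nthm nthS /kk eqxx.
rewrite cylE /incr !(poisson_increments NP) ?nth0 ?nthS//; last 2 first.
- by rewrite nthm ltW.
- by move=> i im; apply: lt_nth; rewrite ltnS ltnW.
rewrite (increment_prob _ (ltW t0))// big_ord_recr/= EFinM nthS nthm.
by rewrite {2}/kk eqxx.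
Qed.

Lemma path_events_indep (t : R) k A : 0 < t -> t < 1 -> path_events N t A ->
  P (A `&` [set w | (N 1 w - N t w)%N = k]) =
  (P A * P [set w | (N 1 w - N t w)%N = k])%E.
Proof.
move=> t0 t1 tA.
(* Time t must be among the observed ones, as poisson_increments gives the joint
   law of consecutive increments only. *)
pose G := [set E | exists L : seq (R * nat),
  [/\ forall p, p \in L -> 0 <= p.1 <= t, exists v, (t, v) \in L &
      E = cylinder L]].
have Gt : G `<=` path_events N t.
  move=> _ [L [Lt _ ->]].
  rewrite (_ : cylinder L = \bigcap_(p in [set` L]) [set w | N p.1 w = p.2])//.
  apply: (@fin_bigcap_measurable _ (path_sigma t)) => // p pL.
  by apply: path_events_count; exact: Lt.
have Gm : G `<=` measurable.
  by move=> E /Gt; apply: path_events_measurable; exact: ltW.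
have mB : measurable [set w | (N 1 w - N t w)%N = k].
  by apply: (@path_events_measurable 1) => //; apply: path_events_increment; exact: ltW.
apply: (@indep_sigma _ _ _ P G) => //.
- move=> _ _ [L1 [H1 [v1 V1] ->]] [L2 [H2 [v2 V2] ->]]; exists (L1 ++ L2); split.
  + by move=> p; rewrite mem_cat => /orP[/H1|/H2].
  + by exists v1; rewrite mem_cat V1.
  + apply/seteqP; split => [w [w1 w2] p|w ww].
      by rewrite mem_cat => /orP[/w1|/w2].
    by split => p pL; apply: ww; rewrite mem_cat pL ?orbT.
- by move=> _ [L [Lt Lv ->]]; exact: cylinder_indep.
- move: A tA; apply: smallest_sub; first exact: smallest_sigma_algebra.
  move=> _ [u [m [/andP[u0 ut] ->]]].
  (* An observation at [u] alone is split according to the value at [t], so the cylinders that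
     observe [t] still generate all path events. *)
  rewrite (_ : [set _ | _] = \bigcup_v cylinder [:: (u, m); (t, v)]).
    apply: (@bigcupT_measurable _ (g_sigma_algebraType G)) => v.
    apply: sub_sigma_algebra; exists [:: (u, m); (t, v)]; split => //.
    + move=> p; rewrite !inE => /orP[|] /eqP-> /=; first by rewrite u0.
      by rewrite lexx ltW.
    + by exists v; rewrite !inE eqxx orbT.
  apply/seteqP; split => [w Nw|w [v _ /(_ (u, m))]].
    exists (N t w) => // p; rewrite !inE => /orP[|] /eqP-> //=.
  by rewrite !inE eqxx => /(_ isT).
Qed.

End one_process.

(** * Independence for all types jointly and for the seed *)

Section arrival_independence.
Variables (R : realType) (I : instance R) (M : arrivals I).
Let J := online_type I.
Let P := arr_prob M.
Let N := @Defs.count R I M.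

Definition increment (t : R) (j : J) (k : nat) : set (arr_space M) :=
  [set w | (N j 1 w - N j t w)%N = k].

(* [None] leaves the increment of that type unconstrained. *)
Definition increments (t : R) (k : J -> option nat) : set (arr_space M) :=
  \bigcap_(j in [set: J]) oapp (increment t j) setT (k j).

Definition history_sigma (t : R) := g_sigma_algebraType
  (\bigcup_(j in [set: J]) path_events (N j) t).

Lemma path_history t j A : path_events (N j) t A -> history N t A.
Proof. by move=> jA; apply: sub_sigma_algebra; exists j. Qed.

Lemma history_measurable t A : t <= 1 -> history N t A -> measurable A.
Proof.
move=> t1; apply: smallest_sub; first exact: sigma_algebra_measurable.
by move=> B [j _]; apply: path_events_measurable t1; exact: count_poisson.
Qed.

Lemma history_bigcap t (E : J -> set (arr_space M)) :
  (forall j, history N t (E j)) -> history N t (\bigcap_(j in [set: J]) E j).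
Proof.
by move=> HE; apply: (@fin_bigcap_measurable _ (history_sigma t)) => // j _; exact: HE.
Qed.

Lemma path_events_oincrement t j o : 0 <= t -> t <= 1 ->
  path_events (N j) 1 (oapp (increment t j) setT o).
Proof.
move=> t0 t1; case: o => [k|] /=; first exact: path_events_increment.
exact: (@measurableT _ (path_sigma (N j) 1)).
Qed.

Lemma increments_measurable t k : 0 <= t -> t <= 1 ->
  measurable (increments t k).
Proof.
move=> t0 t1; apply: (history_measurable (lexx 1)).
by apply: history_bigcap => j; apply: path_history; exact: path_events_oincrement.
Qed.

Lemma increments_prob t k : 0 <= t -> t <= 1 ->
  P (increments t k) = (\prod_j P (oapp (increment t j) setT (k j)))%E.
Proof.
move=> t0 t1; apply: (@count_independent _ _ M) => j.
exact: path_events_oincrement.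
Qed.

Lemma path_events_widen j s t A : s <= t -> path_events (N j) s A ->
  path_events (N j) t A.
Proof.
move=> st; apply: smallest_sub; first exact: smallest_sigma_algebra.
move=> _ [u [k [/andP[u0 us] ->]]]; apply: path_events_count.
by rewrite u0 (le_trans us).
Qed.

(** Intersections of one event per type form a generating pi-system. Mutual independence of the
    types factors both sides over the types, and each factor is the statement for one process. *)
Lemma history_indep t k A : 0 < t -> t < 1 -> history N t A ->
  P (A `&` increments t k) = (P A * P (increments t k))%E.
Proof.
move=> t0 t1 tA.
pose G := [set E | exists F : J -> set (arr_space M),
  (forall j, path_events (N j) t (F j)) /\ E = \bigcap_(j in [set: J]) F j].
have mB := increments_measurable k (ltW t0) (ltW t1).
have Gt : G `<=` history N t.
  by move=> _ [F [HF ->]]; apply: history_bigcap => j; exact: path_history.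
apply: (@indep_sigma _ _ _ P G) => //.
- move=> _ _ [F1 [H1 ->]] [F2 [H2 ->]]; exists (fun j => F1 j `&` F2 j); split.
    move=> j; apply: (@measurableI _ (path_sigma (N j) t)); first exact: H1.
    exact: H2.
  by rewrite bigcapI.
- by move=> E /Gt; apply: history_measurable; exact: ltW.
- move=> _ [F [HF ->]]; rewrite -bigcapI.
  (* Independence of the types is stated for events up to time 1, hence the widening. *)
  have HF1 j := path_events_widen (ltW t1) (HF j).
  rewrite (@count_independent _ _ M); last first.
    move=> j; apply: (@measurableI _ (path_sigma (N j) 1)); first exact: HF1.
    exact: path_events_oincrement (ltW t0) (ltW t1).
  rewrite (@count_independent _ _ M)// increments_prob ?ltW// -big_split/=.
  apply: eq_bigr => j _; case: (k j) => [v|] /=.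
    exact: (path_events_indep (count_poisson M j)).
  by rewrite setIT probability_setT mule1.
- move: A tA; apply: smallest_sub; first exact: smallest_sigma_algebra.
  move=> A [j _ jA]; apply: sub_sigma_algebra.
  exists (fun i => if i == j then A else setT); split.
    move=> i; case: eqVneq => [->//|_].
    exact: (@measurableT _ (path_sigma (N i) t)).
  apply/seteqP; split => [w Aw i _|w /(_ j Logic.I)]; first by case: eqP.
  by rewrite eqxx.
Qed.

Section seed.
Variables (dS : measure_display) (S : measurableType dS) (Q : probability S R).

Lemma information_measurable t E : t <= 1 ->
  information (M := M) (S := S) t E -> measurable E.
Proof.
move=> t1; apply: smallest_sub; first exact: sigma_algebra_measurable.
move=> _ [A [B [tA mB ->]]]; apply: measurableX => //.
exact: history_measurable tA.
Qed.

(** On generating rectangles the seed contributes the same factor to both sides, which leaves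
    [history_indep]. This is where a decision that does not anticipate becomes independent of later
    arrivals. *)
Lemma information_indep t k E : 0 < t -> t < 1 ->
    information (M := M) (S := S) t E ->
  (P \x Q)%E (E `&` (increments t k `*` setT)) =
  ((P \x Q)%E E * P (increments t k))%E.
Proof.
move=> t0 t1 tE.
have mB := increments_measurable k (ltW t0) (ltW t1).
have BE : (P \x Q)%E (increments t k `*` setT) = P (increments t k).
  by rewrite product_measure1E// [X in (_ * X)%E]probability_setT mule1.
rewrite -[in RHS]BE.
pose G := [set E | exists A B, [/\ history N t A, measurable B &
  E = A `*` B] ] : set (set (arr_space M * S)).
apply: (@indep_sigma _ _ _ (P \x Q)%E G) => //.
- move=> _ _ [A1 [B1 [H1 m1 ->]]] [A2 [B2 [H2 m2 ->]]].
  exists (A1 `&` A2), (B1 `&` B2); split; last by rewrite setXI.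
    exact: (@measurableI _ (history_sigma t)).
  exact: measurableI.
- move=> X GX; apply: (@information_measurable t); first exact: ltW.
  exact: sub_sigma_algebra.
- exact: measurableX.
- move=> _ [A [B [tA mB' ->]]].
  have mA : measurable A by apply: history_measurable tA; exact: ltW.
  have mAI : measurable (A `&` increments t k) by exact: measurableI.
  rewrite -setXI setIT [X in _ = (_ * X)%E]BE.
  rewrite [LHS]product_measure1E// [X in (X * _)%E = _]history_indep//.
  by rewrite [X in _ = (X * _)%E]product_measure1E// muleAC.
Qed.

End seed.
End arrival_independence.

(** * Bounded random variables and sections of events *)

(** Vectors of naturals over a finite type are countably many, so even an arbitrary property [p]
    yields a countable union of level events. *)
Lemma ffun_levels_measurable (d : measure_display) (T : measurableType d)
    (J : finType) (f : J -> T -> nat) (p : {ffun J -> nat} -> Prop) :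
    (forall j k, measurable [set w | f j w = k]) ->
  measurable [set w | p [ffun j => f j w]].
Proof.
move=> mf.
rewrite (_ : [set w | _] = \bigcup_(a : {ffun J -> nat})
    (\bigcap_(j in [set: J]) [set w | f j w = a j] `&` [set _ | p a])); last first.
  apply/seteqP; split => [w pw|w [a _ [Ha pa]]].
    by exists [ffun j => f j w] => //; split => // j _ /=; rewrite ffunE.
  rewrite /= (_ : [ffun j => f j w] = a)//.
  by apply/ffunP => j; rewrite ffunE; exact: Ha.
apply: countable_bigcupT_measurable => [//|a]; apply: measurableI.
  by apply: fin_bigcap_measurable => // j _; exact: mf.
by have [pa|pa] := pselect (p a); [rewrite (_ : mkset _ = setT)|
  rewrite (_ : mkset _ = set0)]; rewrite ?predeqE//; split.
Qed.

Lemma nat_rv_measurable (R : realType) (d : measure_display)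
    (T : measurableType d) (f : T -> nat) (phi : nat -> R) :
    (forall k, measurable [set w | f w = k]) ->
  measurable_fun setT (phi \o f).
Proof.
move=> mf _ Y _; rewrite setTI.
rewrite (_ : _ @^-1` _ = \bigcup_(k in [set k | Y (phi k)]) [set w | f w = k]).
  by apply: bigcup_measurable => k _; exact: mf.
apply/seteqP; split => [w Yw|w [k Yk /= fk]].
  by exists (f w).
by rewrite /preimage /= fk.
Qed.

Lemma measurable_bigmin (R : realType) (d : measure_display)
    (T : measurableType d) (I : Type) (s : seq I) (c : I -> T -> bool)
    (f : I -> T -> R) :
    (forall i, measurable_fun setT (c i)) ->
    (forall i, measurable_fun setT (f i)) ->
  measurable_fun setT (fun w => \big[Num.min/1]_(i <- s | c i w) f i w).
Proof.
move=> mc mf; elim: s => [|i s IH].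
  by under eq_fun do rewrite big_nil; exact: measurable_cst.
under eq_fun do rewrite big_cons.
by apply: measurable_fun_ifT => //; exact: measurable_minr.
Qed.

Section bounded_random_variables.
Variables (R : realType) (d : measure_display) (T : measurableType d).
Variable P : probability T R.
Implicit Types f g : T -> R.

Definition bounded_rv (f : T -> R) :=
  measurable_fun setT f /\ exists b, forall w, `|f w| <= b.

Lemma bounded_rv_integrable f : bounded_rv f -> P.-integrable setT (EFin \o f).
Proof.
move=> [mf [b fb]]; apply: measurable_bounded_integrable => //.
  by rewrite [X in (X < _)%E]probability_setT ltry.
exists b; split=> [|c bc w _]; first exact: num_real.
  by rewrite /= (le_trans (fb w))// ltW.
Qed.

Lemma bounded_rv_cst k : bounded_rv (fun=> k).
Proof. by split => //; exists `|k|. Qed.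

Lemma bounded_rvD f g : bounded_rv f -> bounded_rv g -> bounded_rv (fun w => f w + g w).
Proof.
move=> [mf [b fb]] [mg [c gc]]; split; first exact: measurable_funD.
by exists (b + c) => w; rewrite (le_trans (ler_normD _ _))// lerD.
Qed.

Lemma bounded_rvM f g : bounded_rv f -> bounded_rv g -> bounded_rv (fun w => f w * g w).
Proof.
move=> [mf [b fb]] [mg [c gc]]; split; first exact: measurable_funM.
by exists (b * c) => w; rewrite normrM ler_pM.
Qed.

Lemma bounded_rvB f g : bounded_rv f -> bounded_rv g -> bounded_rv (fun w => f w - g w).
Proof.
move=> [mf [b fb]] [mg [c gc]]; split; first exact: measurable_funB.
by exists (b + c) => w; rewrite (le_trans (ler_normB _ _))// lerD.
Qed.

Lemma bounded_rv_indic A : measurable A -> bounded_rv (\1_A).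
Proof.
move=> mA; split; first exact: measurable_indic.
by exists 1 => w; rewrite ger0_norm// indicE; case: (_ \in _).
Qed.

Lemma bounded_rv_sum (I : Type) (s : seq I) (f : I -> T -> R) :
  (forall i, bounded_rv (f i)) -> bounded_rv (fun w => \sum_(i <- s) f i w).
Proof.
move=> bf; elim: s => [|i s IH].
  by under eq_fun do rewrite big_nil; exact: bounded_rv_cst.
by under eq_fun do rewrite big_cons; exact: bounded_rvD.
Qed.

Lemma bounded_rv_unit f : measurable_fun setT f -> (forall w, 0 <= f w <= 1) ->
  bounded_rv f.
Proof.
by move=> mf f01; split => //; exists 1 => w; have /andP[? ?] := f01 w; rewrite ger0_norm.
Qed.

Lemma mean_cst k : \int[P]_w k = k.
Proof. by rewrite Rintegral_cst// [X in fine X]probability_setT mulr1. Qed.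

Lemma meanD f g : bounded_rv f -> bounded_rv g ->
  \int[P]_w (f w + g w) = \int[P]_w f w + \int[P]_w g w.
Proof. by move=> ? ?; rewrite RintegralD//; exact: bounded_rv_integrable. Qed.

Lemma meanB f g : bounded_rv f -> bounded_rv g ->
  \int[P]_w (f w - g w) = \int[P]_w f w - \int[P]_w g w.
Proof. by move=> ? ?; rewrite RintegralB//; exact: bounded_rv_integrable. Qed.

Lemma meanZ k f : bounded_rv f -> \int[P]_w (k * f w) = k * \int[P]_w f w.
Proof. by move=> ?; rewrite RintegralZl//; exact: bounded_rv_integrable. Qed.

Lemma mean_sum (I : Type) (s : seq I) (f : I -> T -> R) :
    (forall i, bounded_rv (f i)) ->
  \int[P]_w (\sum_(i <- s) f i w) = \sum_(i <- s) \int[P]_w f i w.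
Proof.
move=> bf; elim: s => [|i s IH].
  by under eq_Rintegral do rewrite big_nil; rewrite mean_cst big_nil.
under eq_Rintegral do rewrite big_cons.
by rewrite meanD//; [rewrite big_cons IH|exact: bounded_rv_sum].
Qed.

Lemma le_mean f g : bounded_rv f -> bounded_rv g -> (forall w, f w <= g w) ->
  \int[P]_w f w <= \int[P]_w g w.
Proof. by move=> ? ? ?; apply: le_Rintegral => //; exact: bounded_rv_integrable. Qed.

Lemma mean_indic A : measurable A -> \int[P]_w \1_A w = fine (P A).
Proof. by move=> mA; rewrite /Rintegral integral_indic// setIT. Qed.

End bounded_random_variables.

(** * Conditional probabilities given the arrivals *)

Section sections.
Variables (R : realType) (d d' : measure_display).
Variables (T : measurableType d) (S : measurableType d').
Variables (P : probability T R) (Q : probability S R).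

(** The probability over the seed alone, with [w] fixed; under the product measure it is the
    conditional probability of [E] given the first coordinate. *)
Definition section_prob (E : set (T * S)) (w : T) : R := fine (Q (xsection E w)).

Lemma section_prob_ge0 E w : 0 <= section_prob E w.
Proof. exact/fine_ge0. Qed.

Lemma section_prob_le E F w : measurable E -> measurable F ->
  (forall s, E (w, s) -> F (w, s)) -> section_prob E w <= section_prob F w.
Proof.
move=> mE mF EF; rewrite fine_le ?fin_num_measure//; try exact: measurable_xsection.
apply: le_measure; rewrite ?inE; try exact: measurable_xsection.
by move=> s /xsectionP Es; apply/xsectionP/EF.
Qed.

Lemma section_probC E w : measurable E ->
  section_prob (~` E) w = 1 - section_prob E w.
Proof.
move=> mE; rewrite /section_prob.
have -> : xsection (~` E) w = ~` xsection E w.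
  by apply/seteqP; split => s; rewrite /= !xsectionP.
rewrite probability_setC; last exact: measurable_xsection.
by rewrite fineB// fin_num_measure//; exact: measurable_xsection.
Qed.

Lemma section_prob_le1 E w : measurable E -> section_prob E w <= 1.
Proof.
by move=> mE; have := section_prob_ge0 (~` E) w; rewrite section_probC// subr_ge0.
Qed.

Lemma section_prob_rv E : measurable E -> bounded_rv (section_prob E).
Proof.
move=> mE; apply: bounded_rv_unit => [|w].
  by apply: measurableT_comp => //; exact: measurable_fun_xsection.
by rewrite section_prob_ge0 section_prob_le1.
Qed.

Lemma sum_section_prob_le1 (J : finType) (E : J -> set (T * S)) w :
    (forall j, measurable (E j)) ->
    (forall i j z, E i z -> E j z -> i = j) ->
  \sum_j section_prob (E j) w <= 1.
Proof.
move=> mE dE; rewrite /section_prob.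
have mxE j : measurable (xsection (E j) w) by exact: measurable_xsection.
have -> : \sum_j fine (Q (xsection (E j) w)) =
    fine (Q (\bigcup_(j in [set: J]) xsection (E j) w)).
  rewrite measure_fin_bigcup//; last 2 first.
  - exact: finite_finset.
  - by move=> i j _ _ [s [/xsectionP Es /xsectionP Fs]]; exact: dE Es Fs.
  have -> : [set: J] = [set` index_enum J].
    by apply/seteqP; split => j //= _; exact: mem_index_enum.
  rewrite -fsbig_seq ?index_enum_uniq//= sum_fine// => j _.
  exact: fin_num_measure.
have mU : measurable (\bigcup_(j in [set: J]) xsection (E j) w).
  by apply: fin_bigcup_measurable.
by rewrite -lee_fin fineK ?fin_num_measure// probability_le1.
Qed.

(** The product measure is by definition the integral of the measures of sections, and intersecting
    with [B] times the whole seed space keeps or empties each section. *)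
Lemma mean_section_prob E B : measurable E -> measurable B ->
  \int[P]_w (section_prob E w * \1_B w) = fine ((P \x Q)%E (E `&` (B `*` setT))).
Proof.
move=> mE mB; congr fine; apply: eq_integral => w _ /=.
rewrite xsectionI indicE; have [wB|wB] := boolP (w \in B).
  rewrite in_xsectionX// setIT mulr1 fineK// fin_num_measure//.
  exact: measurable_xsection.
by rewrite notin_xsectionX// setI0 measure0 mulr0.
Qed.

Lemma mean_bool (X : T * S -> nat) w : (forall z, (X z <= 1)%N) ->
    measurable [set z | X z = 1%N] ->
  \int[Q]_s (X (w, s))%:R = section_prob [set z | X z = 1%N] w.
Proof.
move=> X1 mX; rewrite -[RHS]mean_indic; last exact: measurable_xsection.
apply: eq_Rintegral => s _; rewrite indicE mem_xsection.
congr (_%:R); have := X1 (w, s).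
have [|] := boolP ((w, s) \in _); first by rewrite inE /= => ->.
by rewrite notin_setE /=; case: (X _) => [|[|]].
Qed.

End sections.

(** * Equal shares *)

Section singleton_groups.
Variables (R : realType) (I : instance R) (M : arrivals I).
Let J := online_type I.
Let P := arr_prob M.
Let N := @Defs.count R I M.
Hypothesis singleton_groups : groups I = [set [set j]%SET | j : J]%SET.
Hypothesis capacity1 : capacity I = 1%N.

Definition arrival_total (w : arr_space M) : nat := (\sum_j N j 1 w)%N.

(* The fairness of a clairvoyant algorithm serving a uniformly random arrival. *)
Definition equal_share (w : arr_space M) : R :=
  if arrival_total w == 0%N then 1 else (arrival_total w)%:R^-1.

Lemma counts_history t (p : {ffun J -> nat} -> Prop) : 0 <= t ->
  history N t [set w | p [ffun j => N j t w]].
Proof.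
move=> t0; apply: (@ffun_levels_measurable _ (history_sigma M t)) => j k.
by apply: path_history; apply: path_events_count; rewrite t0 lexx.
Qed.

Lemma counts_measurable (p : {ffun J -> nat} -> Prop) :
  measurable [set w | p [ffun j => N j 1 w]].
Proof.
by apply: (history_measurable (lexx 1)); apply: counts_history; exact: ler01.
Qed.

Lemma sum_count_measurable (G : {set J}) k :
  measurable [set w | (\sum_(j in G) N j 1 w)%N = k].
Proof.
have := counts_measurable (fun a => (\sum_(j in G) a j)%N = k).
congr measurable; apply/funext => w.
by rewrite /mkset; congr (_ = _); apply: eq_bigr => j _; rewrite ffunE.
Qed.

Lemma equal_share_ge0 w : 0 <= equal_share w.
Proof. by rewrite /equal_share; case: eqP => // _; rewrite invr_ge0. Qed.

Lemma equal_share_le1 w : equal_share w <= 1.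
Proof.
rewrite /equal_share; case: eqP => // /eqP; rewrite -lt0n => K0.
by rewrite invf_le1 ?ltr0n// ler1n.
Qed.

Lemma equal_share_rv : bounded_rv equal_share.
Proof.
apply: bounded_rv_unit => [|w]; last by rewrite equal_share_ge0 equal_share_le1.
rewrite (_ : equal_share = (fun k => if k == 0%N then 1 else k%:R^-1) \o arrival_total)//.
apply: nat_rv_measurable => k.
have := sum_count_measurable [set: J]%SET k; congr measurable; apply/funext => w.
by rewrite /mkset; congr (_ = _); apply: eq_bigl => j; rewrite inE.
Qed.

Section fairness.
Variables (dS : measure_display) (S : measurableType dS) (Q : probability S R).
Variable X : J -> arr_space M * S -> nat.
Hypothesis X_measurable : forall j k, measurable [set z | X j z = k].
Hypothesis X_capacity : forall z, (\sum_j X j z <= 1)%N.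

Let arrived (G : {set J}) w := (\sum_(j in G) N j 1 w)%N.

Definition realized_fairness (w : arr_space M) : R :=
  \big[Num.min/1]_(G in groups I | (0 < arrived G w)%N)
    ((\int[Q]_s (\sum_(j in G) X j (w, s))%N%:R) / (arrived G w)%:R).

Definition served (j : J) : set (arr_space M * S) := [set z | X j z = 1%N].

Lemma served_measurable j : measurable (served j). Proof. exact: X_measurable. Qed.

Lemma X_le1 j z : (X j z <= 1)%N.
Proof. by apply: leq_trans (X_capacity z); rewrite (bigD1 j)//= leq_addr. Qed.

Lemma served_inj i j z : served i z -> served j z -> i = j.
Proof.
rewrite /served /= => Xi Xj; apply: contraTeq (X_capacity z) => ij.
by rewrite (bigD1 i)//= (bigD1 j) 1?eq_sym//= Xi Xj.
Qed.

Lemma group_service j w : \int[Q]_s (\sum_(i in [set j]%SET) X i (w, s))%N%:R =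
  section_prob Q (served j) w.
Proof.
by under eq_Rintegral do rewrite big_set1; rewrite mean_bool//; exact: X_le1.
Qed.

Lemma realized_fairness_le j w : (0 < N j 1 w)%N ->
  realized_fairness w <= section_prob Q (served j) w / (N j 1 w)%:R.
Proof.
move=> Nj; rewrite /realized_fairness.
have := @bigmin_le_cond _ _ _ 1 [set j]%SET
  (fun G => (G \in groups I) && (0 < arrived G w)%N)
  (fun G => (\int[Q]_s (\sum_(j in G) X j (w, s))%N%:R) / (arrived G w)%:R).
rewrite /arrived big_set1 group_service; apply.
by rewrite singleton_groups imset_f.
Qed.

Lemma le_realized_fairness v w : v <= 1 ->
    (forall j, (0 < N j 1 w)%N -> v <= section_prob Q (served j) w / (N j 1 w)%:R) ->
  v <= realized_fairness w.
Proof.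
move=> v1 Hv; apply: le_bigmin => // G /andP[].
rewrite singleton_groups => /imsetP[j _ ->]; rewrite group_service /arrived big_set1.
exact: Hv.
Qed.

Lemma realized_fairness_le1 w : realized_fairness w <= 1.
Proof. exact: bigmin_le_id. Qed.

Lemma realized_fairness_ge0 w : 0 <= realized_fairness w.
Proof.
apply: le_realized_fairness => // j _.
by rewrite divr_ge0// section_prob_ge0.
Qed.

Lemma realized_fairness_rv : bounded_rv realized_fairness.
Proof.
apply: bounded_rv_unit => [|w]; last by rewrite realized_fairness_ge0 realized_fairness_le1.
apply: (@measurable_bigmin _ _ _ _ _
  (fun G w => (G \in groups I) && (0 < arrived G w)%N)) => G.
  apply: (measurable_fun_bool true); rewrite setTI.
  have [GI|GI] := boolP (G \in groups I); last first.
    by rewrite (_ : _ @^-1` _ = set0)//; apply/seteqP; split.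
  rewrite (_ : _ @^-1` _ = ~` [set w | arrived G w = 0%N]).
    by apply: measurableC; exact: sum_count_measurable.
  by apply/seteqP; split => w /=; rewrite lt0n => /eqP.
apply: measurable_funM; last first.
  exact: (nat_rv_measurable (fun k => k%:R^-1) (sum_count_measurable G)).
(* By the capacity a group is served at most once in total, so its expected service is again a
   section probability. *)
have mG : measurable [set z | (\sum_(j in G) X j z)%N = 1%N].
  have := @ffun_levels_measurable _ _ _ X (fun a => (\sum_(j in G) a j)%N = 1%N) X_measurable.
  congr measurable; apply/funext => z.
  by rewrite /mkset; congr (_ = _); apply: eq_bigr => j _; rewrite ffunE.
rewrite (_ : (fun w => _) = section_prob Q [set z | (\sum_(j in G) X j z)%N = 1%N]).
  exact: (section_prob_rv _ mG).1.
apply/funext => w; apply: (@mean_bool _ _ _ _ _ Q (fun z => (\sum_(j in G) X j z)%N)) => // z.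
apply: leq_trans (X_capacity z); rewrite [leqRHS](bigID (mem G))/=.
by rewrite (eq_bigl (mem G)) ?leq_addr.
Qed.

(** The fairness times the count of a type is at most the probability of serving that type. Summing
    over the types bounds the fairness times the total by the probability of serving anyone. *)
Lemma realized_fairness_share w : realized_fairness w <= equal_share w.
Proof.
rewrite /equal_share; have [K0|K0] := eqVneq (arrival_total w) 0%N.
  exact: realized_fairness_le1.
have KR : 0 < (arrival_total w)%:R :> R by rewrite ltr0n lt0n.
rewrite -[leRHS]div1r ler_pdivlMr//.
apply: le_trans (sum_section_prob_le1 Q w served_measurable served_inj).
rewrite /arrival_total natr_sum mulr_sumr ler_sum// => j _.
have [->|Nj] := posnP (N j 1 w); first by rewrite mulr0 section_prob_ge0.
by rewrite -ler_pdivlMr ?ltr0n// realized_fairness_le.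
Qed.

End fairness.

Lemma clairvoyant_realized (q : clairvoyant M) :
  [/\ forall j k, measurable [set z | cl_served (c := q) j z = k],
      forall z, (\sum_j cl_served (c := q) j z <= 1)%N &
      clairvoyant_fairness q =
      \int[P]_w realized_fairness (cl_prob q) (@cl_served R I M q) w].
Proof.
split => [j k|z|//]; last by rewrite -capacity1; exact: cl_capacity.
by apply: (information_measurable (lexx 1)); exact: cl_measurable.
Qed.

Lemma optimal_clairvoyant_ge (q : clairvoyant M) :
  clairvoyant_fairness q <= optimal_clairvoyant M.
Proof.
apply: ub_le_sup; last by exists q.
(* The fairness values are bounded by 1, so the supremum is an upper bound of them. *)
exists 1 => _ [q' ->].
have [mX X1 ->] := clairvoyant_realized q'.
rewrite -[leRHS](mean_cst P); apply: le_mean.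
- exact: realized_fairness_rv.
- exact: bounded_rv_cst.
- by move=> w; exact: realized_fairness_le1.
Qed.

(** * A clairvoyant algorithm attaining the equal share *)

Section uniform_service.

Let before (j : J) : pred J := fun i => (enum_rank i < enum_rank j)%N.

(* Lining up the arrivals by type, seed [u] selects the one in position [u] times
   their number. *)
Let selects (j : J) (a : J -> nat) (u : R) : bool :=
  ((\sum_(i | before j i) a i)%N%:R <= u * (\sum_i a i)%N%:R) &&
  (u * (\sum_i a i)%N%:R < (\sum_(i | before j i) a i + a j)%N%:R).

Let chosen (j : J) (z : arr_space M * R) : nat := selects j (fun i => N i 1 z.1) z.2.

Let before_le i j (a : J -> nat) : before j i ->
  (\sum_(k | before i k) a k + a i <= \sum_(k | before j k) a k)%N.
Proof.
move=> ij; rewrite [leqRHS](bigD1 i)//= addnC leq_add2l.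
rewrite big_mkcond [leqRHS]big_mkcond; apply: leq_sum => k _.
rewrite /before; case: ltnP => // ki; rewrite (ltn_trans ki ij)/=.
by case: eqVneq ki => // ->; rewrite ltnn.
Qed.

Let selects_inj i j a u : selects i a u -> selects j a u -> i = j.
Proof.
move=> si sj; apply/eqP/contraT => ij.
wlog lt_ij : i j si sj ij / before j i => [hwlog|].
  have [lt|lt|/val_inj/enum_rank_inj eq] := ltngtP (enum_rank i) (enum_rank j).
  - exact: (hwlog i j).
  - by apply: (hwlog j i) => //; rewrite eq_sym.
  - by rewrite eq eqxx in ij.
have /andP[_ ui] := si; have /andP[uj _] := sj.
have := before_le a lt_ij; rewrite -(ler_nat R) => le_ij.
by have := lt_le_trans ui (le_trans le_ij uj); rewrite ltxx.
Qed.

Let selects_measurable j a : measurable_fun setT (selects j a).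
Proof.
apply: measurable_and.
  by apply: measurable_fun_ler => //; apply: measurable_funM.
by apply: measurable_fun_ltr => //; apply: measurable_funM.
Qed.

(** Splitting by the vector of counts gives a countable union of rectangles, which generate the
    information. *)
Let chosen_measurable j k :
  information (M := M) (S := R) 1 [set z | chosen j z = k].
Proof.
rewrite (_ : [set z | _] = \bigcup_(a : {ffun J -> nat})
    ([set w | [ffun i => N i 1 w] = a] `*` [set u | selects j a u = k :> nat])).
  pose G := [set E | exists A B, [/\ history N 1 A, measurable B &
    E = A `*` B] ] : set (set (arr_space M * R)).
  apply: (@countable_bigcupT_measurable _ (g_sigma_algebraType G)) => // a.
  apply: sub_sigma_algebra.
  exists [set w | [ffun i => N i 1 w] = a], [set u | selects j a u = k :> nat].
  split => //; first by apply: (counts_history (fun b => b = a)).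
  have := selects_measurable j a measurableT (Y := [set b | (b : nat) = k]) Logic.I.
  by rewrite setTI.
apply/seteqP; split => [[w u]|[w u] [a _ [/= <-]]]; rewrite /chosen /= => <-.
  exists [ffun i => N i 1 w] => //; split => //=; congr nat_of_bool.
  by congr selects; apply/funext => i; rewrite ffunE.
by congr nat_of_bool; congr selects; apply/funext => i; rewrite ffunE.
Qed.

(** The selected position lies in a half-open interval whose length is the count of [j], so this
    count is positive. *)
Let chosen_arrived j z : (chosen j z <= N j 1 z.1)%N.
Proof.
rewrite /chosen; case: (boolP (selects _ _ _)) => // /andP[le lt].
by have := le_lt_trans le lt; rewrite ltr_nat; lia.
Qed.

Let chosen_capacity z : (\sum_j chosen j z <= capacity I)%N.
Proof.
pose sel j := selects j (fun i => N i 1 z.1) z.2.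
have -> : (\sum_j chosen j z)%N = #|sel|.
  rewrite -sum1_card [RHS]big_mkcond; apply: eq_bigr => j _.
  have -> : (j \in sel) = selects j (fun i => N i 1 z.1) z.2 by [].
  by rewrite /chosen; case: selects.
rewrite capacity1; by apply/card_le1_eqP => i j si sj; exact: selects_inj sj si.
Qed.

Definition uniform_service : clairvoyant M :=
  @Clairvoyant R I M _ _ (uniform_prob (@ltr01 R)) chosen
    chosen_measurable chosen_arrived chosen_capacity.

Let uniform_itv (a b : R) : 0 <= a -> a <= b -> b <= 1 ->
  uniform_prob (@ltr01 R) `[a, b[%classic = (b - a)%:E.
Proof.
move=> a0 ab b1; rewrite /uniform_prob (eq_integral (fun=> 1%:E)).
  rewrite integral_cst//= mul1e lebesgue_measure_itv/= lte_fin.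
  by move: ab; rewrite le_eqVlt => /orP[/eqP->|->]; rewrite ?ltxx ?subrr ?EFinB.
move=> x; rewrite inE/= in_itv/= => /andP[ax xb].
by rewrite /uniform_pdf (le_trans a0 ax) (le_trans (ltW xb) b1) subr0 invr1.
Qed.

Lemma uniform_service_share w :
  equal_share w <= realized_fairness (cl_prob uniform_service) chosen w.
Proof.
apply: le_realized_fairness => [j k|z||j Nj].
- by apply: (information_measurable (lexx 1)); exact: chosen_measurable.
- by rewrite -capacity1; exact: chosen_capacity.
- exact: equal_share_le1.
have K0 : (0 < arrival_total w)%N.
  by apply: leq_trans Nj _; rewrite /arrival_total (bigD1 j)//= leq_addr.
have KR : 0 < (arrival_total w)%:R :> R by rewrite ltr0n.
rewrite /equal_share eqn0Ngt K0 /=.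
pose c := (\sum_(i | before j i) N i 1 w)%N.
have cK : (c + N j 1 w <= arrival_total w)%N.
  rewrite addnC /arrival_total (bigD1 j)//= leq_add2l /c.
  rewrite big_mkcond [leqRHS]big_mkcond; apply: leq_sum => k _.
  by rewrite /before; case: ltnP => // kj; case: eqVneq kj => // ->; rewrite ltnn.
suff -> : section_prob (uniform_prob (@ltr01 R)) (served chosen j) w =
    (N j 1 w)%:R / (arrival_total w)%:R.
  by rewrite mulrAC divff ?mul1r// pnatr_eq0 -lt0n.
rewrite /section_prob.
(* Dividing positions by the total number of arrivals gives an interval of seeds whose length is the
   share of type [j]. *)
have -> : xsection (served chosen j) w =
    `[c%:R / (arrival_total w)%:R, (c + N j 1 w)%:R / (arrival_total w)%:R[%classic.
  apply/seteqP; split => u /=.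
    move=> /xsectionP; rewrite /served /= /chosen /=; case E: (selects _ _ _) => // _.
    by rewrite in_itv/= ler_pdivrMr// ltr_pdivlMr.
  rewrite in_itv/= ler_pdivrMr// ltr_pdivlMr// => su.
  by apply/xsectionP; rewrite /served /= /chosen /= /selects su.
rewrite [X in fine X]uniform_itv ?divr_ge0//=; last 2 first.
- by rewrite ler_pM2r ?invr_gt0// ler_nat leq_addr.
- by rewrite ler_pdivrMr// mul1r ler_nat.
by rewrite natrD; lra.
Qed.

Lemma mean_equal_share_le : \int[P]_w equal_share w <= optimal_clairvoyant M.
Proof.
apply: le_trans (optimal_clairvoyant_ge uniform_service).
have [mX X1 ->] := clairvoyant_realized uniform_service.
apply: le_mean; first exact: equal_share_rv.
  exact: realized_fairness_rv.
exact: uniform_service_share.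
Qed.

End uniform_service.

End singleton_groups.

(** * Fairness lost after a single early arrival *)

(* The summands are 0, 1/6 and 7/6 for b j = 0, b j = 1 and b j > 1: up to the
   penalty for a repeated type this is the chord of 1 / (1 + s) between s = 1
   and s = 2. *)
Lemma reciprocal_lower_bound (R : realType) (J : finType) (b : J -> nat) :
    (0 < \sum_j b j)%N ->
  2 / 3 - \sum_j (7 / 6 - 7 / 6 * (b j == 0%N)%:R - (b j == 1%N)%:R)
    <= ((1 + \sum_j b j)%N%:R)^-1 :> R.
Proof.
move=> b0; pose phi k : R := 7 / 6 - 7 / 6 * (k == 0%N)%:R - (k == 1%N)%:R.
have phi_ge0 k : 0 <= phi k by rewrite /phi; case: k => [|[|k]] /=; lra.
rewrite -/(\sum_j phi (b j)).
(* A single type with [b j] > 1 already costs 7/6 > 2/3, which makes the left side negative. *)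
have [/existsP[j bj]|/existsPn b1] := boolP [exists j, (1 < b j)%N].
  apply: (@le_trans _ _ 0); last by rewrite invr_ge0.
  rewrite (bigD1 j)//=.
  have : 0 <= \sum_(i | i != j) phi (b i) by apply: sumr_ge0.
  have : phi (b j) = 7 / 6 by rewrite /phi; case: (b j) bj => [|[|k]] //= _; lra.
  lra.
have -> : \sum_j phi (b j) = (\sum_j b j)%N%:R / 6.
  rewrite natr_sum mulr_suml; apply: eq_bigr => j _.
  by have := b1 j; rewrite /phi; case: (b j) => [|[|k]] //= _; lra.
(* What remains is 2/3 - s/6 <= 1/(1 + s), that is (s - 1)(s - 2) >= 0, which holds for every
   positive integer. *)
move: (\sum_j b j)%N b0 => s s0; rewrite natrD.
rewrite -[leRHS]mul1r ler_pdivlMr; last by rewrite ltr_pwDl.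
case: s s0 => [//|[|s]] _; first lra.
have : 0 <= s%:R :> R by [].
rewrite -[s.+2]addn2 natrD; nra.
Qed.

Section first_half.
Variables (R : realType) (I : instance R) (M : arrivals I).
Let J := online_type I.
Let P := arr_prob M.
Let N := @Defs.count R I M.
Hypothesis singleton_groups : groups I = [set [set j]%SET | j : J]%SET.
Hypothesis capacity1 : capacity I = 1%N.
Variable p : online M.
Let Q := on_prob p.

Let late j w := (N j 1 w - N j 2^-1 w)%N.

Definition first_arrival (i : J) : set (arr_space M) :=
  [set w | forall j, N j 2^-1 w = (j == i)].

(** The late events are instances of [increments], the form in which independence from the past is
    available. *)
Definition no_late_arrival : set (arr_space M) :=
  increments (M := M) 2^-1 (fun=> Some 0%N).

Definition late_arrivals (j : J) (k : nat) : set (arr_space M) :=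
  increments (M := M) 2^-1 (fun i => if i == j then Some k else None).

Definition served_early (i : J) : set (arr_space M * on_seed p) :=
  [set z | on_served i 2^-1 z = 1%N].

Let q i := section_prob Q (served_early i).

Let half_itv : 0 <= 2^-1 :> R /\ 2^-1 <= 1 :> R.
Proof. by split; [rewrite invr_ge0|rewrite invf_le1// ler1n]. Qed.

Lemma no_late_arrivalE w : no_late_arrival w <-> (forall j, late j w = 0%N).
Proof. by split => [H j|H j _]; [exact: (H j Logic.I)|exact: H]. Qed.

Lemma late_arrivalsE j k : late_arrivals j k = [set w | late j w = k].
Proof.
apply/seteqP; split => [w /(_ j Logic.I)|w /= H i _]; first by rewrite /= eqxx.
by case: eqVneq => [->|].
Qed.

Lemma first_arrival_history i : history N 2^-1 (first_arrival i).
Proof.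
have := @counts_history _ _ M 2^-1 (fun a => forall j, a j = (j == i)) half_itv.1.
congr (history _ _); apply/funext => w; rewrite /mkset /first_arrival.
by apply/propext; split => H j; have := H j; rewrite ffunE.
Qed.

Lemma first_arrival_measurable i : measurable (first_arrival i).
Proof. exact: history_measurable half_itv.2 (first_arrival_history i). Qed.

Lemma late_arrivals_measurable j k : measurable (late_arrivals j k).
Proof. by apply: increments_measurable; case: half_itv. Qed.

Lemma no_late_arrival_measurable : measurable no_late_arrival.
Proof. by apply: increments_measurable; case: half_itv. Qed.

Lemma served_early_information i : information (S := on_seed p) 2^-1 (served_early i).
Proof. by apply: on_adapted; apply/andP. Qed.

Lemma served_early_measurable i : measurable (served_early i).
Proof. exact: information_measurable half_itv.2 (served_early_information i). Qed.

Lemma online_measurable j k : measurable [set z | on_served (o := p) j 1 z = k].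
Proof.
by apply: (information_measurable (lexx 1)); apply: on_adapted; rewrite ler01 lexx.
Qed.

Lemma online_capacity z : (\sum_j on_served (o := p) j 1 z <= 1)%N.
Proof. by rewrite -capacity1; exact: on_capacity. Qed.

Definition fairness := realized_fairness Q (fun j => on_served (o := p) j 1).

Lemma count_late j w : N j 1 w = (N j 2^-1 w + late j w)%N.
Proof.
rewrite subnKC//; have [? ?] := half_itv.
by apply: (poisson_nondecreasing (count_poisson M j)).
Qed.

(** The group of [i] has one arrival in all, and serving type [i] after time 1/2 would require a
    late arrival of that type. *)
Lemma fairness_no_late i w : first_arrival i w -> no_late_arrival w ->
  fairness w <= q i w.
Proof.
move=> Di /no_late_arrivalE b0.
have Ni : N i 1 w = 1%N by rewrite count_late b0 Di eqxx.
have := @realized_fairness_le _ _ _ singleton_groups _ _ Q _ online_measurable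
  online_capacity i w; rewrite -/(N i 1 w) Ni divr1 => /(_ isT)/le_trans; apply.
apply: section_prob_le => [||s]; [exact: online_measurable|exact: served_early_measurable|].
rewrite /served /served_early /= => X1.
have [h0 h1] := half_itv.
have := on_arrived (o := p) i (w, s) h0 h1 (lexx 1).
have := on_nondecreasing (o := p) i (w, s) h0 h1 (lexx 1).
by rewrite /= -/N X1 -/(late i w) b0; lia.
Qed.

(** With capacity 1, serving [j] excludes having served [i] by time 1/2; several arrivals of [j]
    only lower the ratio of its group. *)
Lemma fairness_late i j w : i != j -> first_arrival i w -> (0 < late j w)%N ->
  fairness w <= 1 - q i w.
Proof.
move=> ij Di bj.
have Nj : (0 < N j 1 w)%N by rewrite count_late addn_gt0 bj orbT.
have := @realized_fairness_le _ _ _ singleton_groups _ _ Q _ online_measurable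
  online_capacity j w Nj => /le_trans; apply.
rewrite -section_probC; last exact: served_early_measurable.
rewrite ler_pdivrMr ?ltr0n//.
apply: (@le_trans _ _ (section_prob Q (~` served_early i) w)); last first.
  by rewrite ler_peMr ?section_prob_ge0// ler1n.
apply: section_prob_le => [||s].
- exact: online_measurable.
- by apply: measurableC; exact: served_early_measurable.
rewrite /served /served_early /= => Xj Xi.
have [h0 h1] := half_itv.
have := on_nondecreasing (o := p) i (w, s) h0 h1 (lexx 1).
have := online_capacity (w, s).
by rewrite (bigD1 i)//= (bigD1 j) 1?eq_sym//= Xi Xj; lia.
Qed.

(* Lower bound, where only i has arrived in the first half, for the fairness lost
   compared with equal_share. *)
Definition loss i w : R :=
  4 / 3 * \1_no_late_arrival w + q i w - 2 * (q i w * \1_no_late_arrival w)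
  + \1_(late_arrivals i 0) w - 4 / 3
  - \sum_j (7 / 6 - 7 / 6 * \1_(late_arrivals j 0) w - \1_(late_arrivals j 1) w).

Let late_indic j k w : \1_(late_arrivals j k) w = (late j w == k)%:R :> R.
Proof.
rewrite late_arrivalsE indicE; congr (nat_of_bool _)%:R.
by apply/idP/eqP; rewrite inE.
Qed.

(** Without late arrivals [equal_share] is 1 and [loss] reduces to 1 - q. Otherwise
    [reciprocal_lower_bound] leaves 1 - q to be shown when [i] does not recur, and 2 - q, which is
    at least 1, when it does. *)
Lemma fairness_loss i w : first_arrival i w ->
  fairness w <= equal_share w - loss i w.
Proof.
move=> Di.
have KE : arrival_total w = (1 + \sum_j late j w)%N.
  transitivity (\sum_j ((j == i) + late j w))%N.
    by apply: eq_bigr => j _; rewrite -/(N j 1 w) count_late Di.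
  rewrite big_split/=; congr addn; rewrite (bigD1 i)//= eqxx big1// => j.
  by move=> /negbTE->.
rewrite /equal_share KE /= /loss.
have -> : \sum_j (7 / 6 - 7 / 6 * \1_(late_arrivals j 0) w
      - \1_(late_arrivals j 1) w) =
    \sum_j (7 / 6 - 7 / 6 * (late j w == 0%N)%:R - (late j w == 1%N)%:R) :> R.
  by apply: eq_bigr => j _; rewrite !late_indic.
rewrite late_indic.
have [b0|] := pselect (no_late_arrival w).
  have := fairness_no_late Di b0.
  rewrite indicE mem_set//; move/no_late_arrivalE : b0 => b0.
  rewrite b0 big1 => [|j _]; last by rewrite b0.
  rewrite addn0 /= invr1 big1 => [|j _]; first by rewrite /=; lra.
  by rewrite b0 /=; lra.
move=> b0; rewrite indicE memNset//.
have [j bj] : exists j, (0 < late j w)%N.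
  apply: contrapT => H; apply: b0; apply/no_late_arrivalE => j.
  by case: (posnP (late j w)) => // bj; case: H; exists j.
have s0 : (0 < \sum_j late j w)%N.
  by apply: leq_trans bj _; rewrite (bigD1 j)//= leq_addr.
have := reciprocal_lower_bound R s0.
suff : fairness w <= 1 - q i w + (1 - (late i w == 0%N)%:R) by rewrite /=; lra.
have q01 : 0 <= q i w <= 1.
  by rewrite section_prob_ge0 section_prob_le1//; exact: served_early_measurable.
have [bi|bi] := eqVneq (late i w) 0%N.
  rewrite subrr addr0; apply: (fairness_late _ Di bj).
  by apply: contraTneq bj => <-; rewrite bi.
have := @realized_fairness_le1 _ _ _ _ _ Q (fun j => on_served (o := p) j 1) w.
rewrite -/fairness /=; lra.
Qed.

(** The events [first_arrival i] are disjoint, so at most one summand is nonzero; outside all of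
    them the bound by [equal_share] suffices. *)
Lemma fairness_le w :
  fairness w <= equal_share w - \sum_i \1_(first_arrival i) w * loss i w.
Proof.
have [[i Di]|nD] := pselect (exists i, first_arrival i w); last first.
  rewrite big1 ?subr0; first exact: realized_fairness_share online_measurable online_capacity _.
  by move=> i _; rewrite indicE memNset ?mul0r// => Di; apply: nD; exists i.
rewrite (bigD1 i)//= big1 ?addr0; last first.
  move=> j ji; rewrite indicE memNset ?mul0r// => Dj.
  by have := Dj i; rewrite Di eqxx eq_sym (negbTE ji).
by rewrite indicE mem_set// mul1r fairness_loss.
Qed.

End first_half.

(** * Mean loss with uniform rates *)

Section uniform_rates.
Variables (R : realType) (I : instance R) (M : arrivals I).
Let J := online_type I.
Let P := arr_prob M.
Let N := @Defs.count R I M.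
Let m : R := #|J|%:R.
Hypothesis types_gt0 : (0 < #|J|)%N.
Hypothesis uniform_rate : forall j : J, rate j = m^-1.

Let m_gt0 : 0 < m. Proof. by rewrite ltr0n. Qed.

Lemma counts_prob t (k : J -> nat) : 0 < t -> t <= 1 ->
  P [set w | forall j, N j t w = k j] = (\prod_j poisson_pmf (t / m) (k j))%:E.
Proof.
move=> t0 t1.
rewrite (_ : [set w | _] = \bigcap_(j in [set: J]) [set w | N j t w = k j]); last first.
  by apply/seteqP; split => w Hw j //=; exact: Hw.
rewrite (@count_independent _ _ M); last first.
  by move=> j; apply: path_events_count; rewrite ltW.
rewrite -prodEFin; apply: eq_bigr => j _.
rewrite -[in RHS](subr0 t) mulrC -(uniform_rate j).
rewrite -(increment_prob (count_poisson M j) (k j) (lexx 0) t0 t1).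
congr (P _); apply/funext => w.
by rewrite /mkset (poisson_start (count_poisson M j)) subn0.
Qed.

Let pmf0 (y : R) : 0 < y -> poisson_pmf y 0 = expR (- y).
Proof. by move=> y0; rewrite /poisson_pmf y0 expr0 invr1 !mul1r. Qed.

Let pmf1 (y : R) : 0 < y -> poisson_pmf y 1 = y * expR (- y).
Proof. by move=> y0; rewrite /poisson_pmf y0 expr1 invr1 mulr1. Qed.

Let prod_pmf0 t : 0 < t -> \prod_(j : J) poisson_pmf (t / m) 0 = expR (- t).
Proof.
move=> t0; rewrite pmf0 ?divr_gt0// prodr_const -expRM_natl mulrN.
by congr (expR (- _)); rewrite mulrCA -/m divff ?mulr1// gt_eqF.
Qed.

Let prod_pmf1 t (i : J) : 0 < t ->
  \prod_(j : J) poisson_pmf (t / m) (j == i) = t / m * expR (- t).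
Proof.
move=> t0; have y0 : 0 < t / m by rewrite divr_gt0.
rewrite -(prod_pmf0 t0) (bigD1 i)//= [in RHS](bigD1 i)//= eqxx pmf1// pmf0//.
rewrite mulrA; congr (_ * _).
by apply: eq_bigr => j /negbTE ->; rewrite pmf0.
Qed.

(** [h] is the probability that nobody arrives in one half of the horizon, and [x] the mean number
    of arrivals of one type in that half. *)
Let h : R := expR (- 2^-1).
Let x : R := 2^-1 / m.

Let x_gt0 : 0 < x. Proof. by rewrite divr_gt0// invr_gt0. Qed.

Let half_gt0 : 0 < 2^-1 :> R. Proof. by rewrite invr_gt0. Qed.
Let half_lt1 : 2^-1 < 1 :> R. Proof. by rewrite invf_lt1// ltr1n. Qed.
Let half_le1 : 2^-1 <= 1 :> R. Proof. exact: ltW. Qed.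

Lemma first_arrival_prob i : fine (P (first_arrival (M := M) i)) = x * h.
Proof. by rewrite [X in fine X]counts_prob// ?ltW//= prod_pmf1. Qed.

Lemma late_arrivals_prob j k :
  P (late_arrivals (M := M) j k) = (poisson_pmf x k)%:E.
Proof.
rewrite late_arrivalsE.
rewrite [LHS](increment_prob (count_poisson M j) k (ltW half_gt0) half_lt1)//.
by rewrite uniform_rate /x; congr (poisson_pmf _ _)%:E; rewrite mulrC; congr (_ / _); lra.
Qed.

Lemma no_late_arrival_prob : P (no_late_arrival (M := M)) = h%:E.
Proof.
rewrite [LHS](@increments_prob _ _ M) ?ltW//=.
rewrite /h -(prod_pmf0 half_gt0) -prodEFin; apply: eq_bigr => j _.
rewrite [LHS](increment_prob (count_poisson M j) 0 (ltW half_gt0) half_lt1)//.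
by rewrite uniform_rate; congr (poisson_pmf _ _)%:E; rewrite mulrC; congr (_ / _); lra.
Qed.

(** From two arrivals on, the share is at most 1/2. The excess of at most 1/2 occurs for zero or one
    arrival, two events of probability exp(-1) = h^2 each. *)
Lemma mean_equal_share_upper : \int[P]_w equal_share w <= 2^-1 + h ^+ 2.
Proof.
pose Z := [set w | forall j, N j 1 w = 0%N].
pose Y i := [set w | forall j, N j 1 w = (j == i)].
have mZ : measurable Z.
  have := counts_measurable M (fun a => forall j, a j = 0%N).
  congr measurable; apply/funext => w; apply/propext.
  by split => H j; have := H j; rewrite ffunE.
have mY i : measurable (Y i).
  have := counts_measurable M (fun a => forall j, a j = (j == i)).
  congr measurable; apply/funext => w; apply/propext.
  by split => H j; have := H j; rewrite ffunE.
have hh : h ^+ 2 = expR (- 1).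
  by rewrite /h -expRM_natl; congr expR; lra.
have bY : bounded_rv (fun w => \sum_i (\1_(Y i) w : R)).
  by apply: bounded_rv_sum => i; exact: bounded_rv_indic.
have bZ : bounded_rv (\1_Z : _ -> R) by exact: bounded_rv_indic.
have bH : bounded_rv (fun _ : arr_space M => 2^-1 : R) by exact: bounded_rv_cst.
apply: (@le_trans _ _
    (\int[P]_w (2^-1 + (2^-1 * \1_Z w + 2^-1 * \sum_i \1_(Y i) w)))).
  apply: le_mean; first exact: equal_share_rv.
    by apply: bounded_rvD => //; apply: bounded_rvD; exact: bounded_rvM.
  move=> w; rewrite /equal_share.
  have S0 : 0 <= \sum_i \1_(Y i) w :> R by apply: sumr_ge0.
  case: eqVneq => K.
    have /mem_set Zw : Z w.
      move=> j; apply/eqP; rewrite -leqn0 -K /arrival_total (bigD1 j)//=.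
      exact: leq_addr.
    by rewrite indicE Zw /=; lra.
  have Z0 : 0 <= \1_Z w :> R by [].
  have [K1|K1] := eqVneq (arrival_total w) 1%N; last first.
    have : (arrival_total w)%:R^-1 <= 2^-1 :> R.
      by rewrite lef_pV2 ?posrE ?ltr0n// ?ler_nat; lia.
    lra.
  have [i Ni] : exists i, (0 < N i 1 w)%N.
    apply: contrapT => H; move/eqP: K; apply; rewrite /arrival_total big1// => j _.
    by apply/eqP; rewrite -leqn0 leqNgt; apply/negP => ?; apply: H; exists j.
  have Yw : Y i w.
    move: K1; rewrite /arrival_total (bigD1 i)//= => K1.
    have sum0 : (\sum_(j | j != i) N j 1 w)%N = 0%N by rewrite /N in Ni *; lia.
    move=> j; case: eqVneq => [->|ji]; first by rewrite /N in Ni *; lia.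
    by move/eqP: sum0; rewrite sum_nat_eq0 => /forallP/(_ j)/implyP/(_ ji)/eqP.
  have Y1 : \1_(Y i) w = 1 :> R by rewrite indicE mem_set.
  rewrite K1 invr1 (bigD1 i)//= Y1.
  have : 0 <= \sum_(j | j != i) \1_(Y j) w :> R by apply: sumr_ge0.
  lra.
rewrite meanD// ?mean_cst; last by apply: bounded_rvD; exact: bounded_rvM.
rewrite meanD//; try exact: bounded_rvM.
rewrite !meanZ// mean_indic// mean_sum; last by move=> i; exact: bounded_rv_indic.
rewrite [X in fine X]counts_prob// prod_pmf0//=.
rewrite (eq_bigr (fun=> m^-1 * expR (- 1))); last first.
  by move=> i _; rewrite mean_indic// [X in fine X]counts_prob// prod_pmf1//= mul1r.
rewrite sumr_const -/J -[X in _ + (_ + _ * X)]mulr_natl -/m mulrA divff ?mul1r ?gt_eqF//.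
by rewrite hh; lra.
Qed.

(** * Mean loss of an online algorithm *)

Section online_algorithm.
Hypothesis singleton_groups : groups I = [set [set j]%SET | j : J]%SET.
Hypothesis capacity1 : capacity I = 1%N.
Variable p : online M.
Let Q := on_prob p.
Let D := @first_arrival R I M.
Let Z := @no_late_arrival R I M.
Let L := @late_arrivals R I M.
Let q i := section_prob Q (served_early (p := p) i).

Let mD i : measurable (D i). Proof. exact: first_arrival_measurable. Qed.
Let mZ : measurable Z. Proof. exact: no_late_arrival_measurable. Qed.
Let mL j k : measurable (L j k). Proof. exact: late_arrivals_measurable. Qed.
Let mU i : measurable (served_early (p := p) i).
Proof. exact: served_early_measurable. Qed.

Let bD i : bounded_rv (\1_(D i) : _ -> R). Proof. exact: bounded_rv_indic. Qed.
Let bZ : bounded_rv (\1_Z : _ -> R). Proof. exact: bounded_rv_indic. Qed.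
Let bL j k : bounded_rv (\1_(L j k) : _ -> R). Proof. exact: bounded_rv_indic. Qed.
Let bq i : bounded_rv (q i). Proof. exact: section_prob_rv. Qed.

Let mean_first i k :
  \int[P]_w (\1_(D i) w * \1_(increments (M := M) 2^-1 k) w) =
  x * h * fine (P (increments (M := M) 2^-1 k)).
Proof.
have mk : measurable (increments (M := M) 2^-1 k).
  by apply: increments_measurable; rewrite ltW.
have hD : history N 2^-1 (D i) by exact: first_arrival_history.
transitivity (\int[P]_w \1_(D i `&` increments (M := M) 2^-1 k) w).
  by apply: eq_Rintegral => w _; rewrite indicI.
rewrite mean_indic; last exact: measurableI.
rewrite [X in fine X](history_indep k half_gt0 half_lt1 hD).
by rewrite fineM ?fin_num_measure// first_arrival_prob.
Qed.

(** The service by time 1/2 and the event [D i] are both known at that time, so the absence of late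
    arrivals is independent of them and factors out as [h]. *)
Let mean_first_served i :
  \int[P]_w (\1_(D i) w * (q i w * \1_Z w)) = \int[P]_w (\1_(D i) w * q i w) * h.
Proof.
transitivity (\int[P]_w (q i w * \1_(D i `&` Z) w)).
  by apply: eq_Rintegral => w _; rewrite indicI mulrCA.
have -> : \int[P]_w (\1_(D i) w * q i w) = \int[P]_w (q i w * \1_(D i) w).
  by apply: eq_Rintegral => w _; rewrite mulrC.
rewrite !mean_section_prob//; last exact: measurableI.
rewrite (_ : _ `&` _ = (served_early (p := p) i `&` (D i `*` setT)) `&` (Z `*` setT)).
  have iE : information (S := on_seed p) 2^-1
      (served_early (p := p) i `&` (D i `*` setT)).
    pose G := [set E | exists A B, [/\ history N 2^-1 A, measurable B &
      E = A `*` B] ] : set (set (arr_space M * on_seed p)).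
    apply: (@measurableI _ (g_sigma_algebraType G)).
      exact: served_early_information.
    apply: sub_sigma_algebra; exists (D i), setT; split => //.
    exact: first_arrival_history.
  rewrite [X in fine X](information_indep Q (fun=> Some 0%N) half_gt0 half_lt1 iE).
  have fE : (P \x Q)%E (served_early (p := p) i `&` (D i `*` setT)) \is a fin_num.
    have mE := information_measurable half_le1 iE.
    exact: (@fin_num_measure _ _ _ (P \x Q : probability _ R)%E _ mE).
  by rewrite [X in (_ * X)%E]no_late_arrival_prob fineM.
by rewrite -setIA -setXI setIT.
Qed.

(** By independence the only quantity left that depends on the algorithm is [u], with coefficient 1
    - 2h <= 0. The worst case is thus u = x h, where the early arrival is always served. *)
Lemma mean_loss_ge i : 2^-1 <= h ->
  x * h * (7 / 12 - 2 / 3 * h - 3 / 2 * x) <= \int[P]_w (\1_(D i) w * loss p i w).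
Proof.
move=> h2; set u := \int[P]_w (\1_(D i) w * q i w).
have u_le : u <= x * h.
  rewrite -(first_arrival_prob i) -mean_indic//.
  apply: le_mean => // [|w]; first exact: bounded_rvM.
  by rewrite ler_piMr// section_prob_le1.
have EZ : \int[P]_w (\1_(D i) w * \1_Z w) = x * h * h.
  by rewrite mean_first [X in fine X]no_late_arrival_prob.
have EL j k : \int[P]_w (\1_(D i) w * \1_(L j k) w) = x * h * poisson_pmf x k.
  by rewrite mean_first [X in fine X]late_arrivals_prob.
have bDZ : bounded_rv (fun w => \1_(D i) w * \1_Z w : R) by exact: bounded_rvM.
have bDL j k : bounded_rv (fun w => \1_(D i) w * \1_(L j k) w : R).
  exact: bounded_rvM.
have bDq : bounded_rv (fun w => \1_(D i) w * q i w) by exact: bounded_rvM.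
have bDqZ : bounded_rv (fun w => \1_(D i) w * (q i w * \1_Z w)).
  by apply: bounded_rvM => //; exact: bounded_rvM.
have bc k : bounded_rv (fun _ : arr_space M => k : R) by exact: bounded_rv_cst.
pose S j w : R := 7 / 6 * \1_(D i) w - 7 / 6 * (\1_(D i) w * \1_(L j 0) w)
  - \1_(D i) w * \1_(L j 1) w.
have bS j : bounded_rv (S j).
  by apply: bounded_rvB => //; apply: bounded_rvB; exact: bounded_rvM.
have -> : \int[P]_w (\1_(D i) w * loss p i w) =
    \int[P]_w (4 / 3 * (\1_(D i) w * \1_Z w) + \1_(D i) w * q i w
      - 2 * (\1_(D i) w * (q i w * \1_Z w)) + \1_(D i) w * \1_(L i 0) w
      - 4 / 3 * \1_(D i) w - \sum_j S j w).
  apply: eq_Rintegral => w _; rewrite /loss mulrBr; congr (_ - _).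
    by rewrite -/(q i w) -/Z -/(L i 0%N); ring.
  by rewrite mulr_sumr; apply: eq_bigr => j _; rewrite /S -/(L j 0%N) -/(L j 1%N); ring.
have b1 := bounded_rvM (bc (4 / 3)) bDZ.
have b2 := bounded_rvD b1 bDq.
have b3 := bounded_rvM (bc 2) bDqZ.
have b4 := bounded_rvB b2 b3.
have b5 := bounded_rvD b4 (bDL i 0%N).
have b6 := bounded_rvM (bc (4 / 3)) (bD i).
rewrite (meanB P (bounded_rvB b5 b6)); last exact: bounded_rv_sum.
rewrite (meanB P b5 b6) (meanD P b4 (bDL i 0%N)) (meanB P b2 b3) (meanD P b1 bDq).
rewrite !meanZ// mean_sum// mean_first_served EZ EL mean_indic// first_arrival_prob.
rewrite (eq_bigr (fun=> x * h * (7 / 6 - 7 / 6 * poisson_pmf x 0 - poisson_pmf x 1))); last first.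
  move=> j _; have b7 := bounded_rvM (bc (7 / 6)) (bD i).
  have b8 := bounded_rvM (bc (7 / 6)) (bDL j 0%N).
  rewrite (meanB P (bounded_rvB b7 b8) (bDL j 1%N)) (meanB P b7 b8) !meanZ//.
  by rewrite !EL mean_indic// first_arrival_prob; ring.
rewrite sumr_const -/J -[X in _ <= _ - X]mulr_natl -/m -/u pmf0// pmf1//.
set e := expR (- x).
have e_ge : 1 - x <= e by rewrite /e; exact: expR_ge1Dx.
have mx : m * x = 2^-1 by rewrite /x mulrCA divff ?mulr1// gt_eqF.
have ->: m * (x * h * (7 / 6 - 7 / 6 * e - x * e)) =
  h * (m * x) * (7 / 6 - 7 / 6 * e - x * e) by ring.
rewrite mx.
have h0 : 0 <= h by rewrite expR_ge0.
have xh0 : 0 <= x * h by rewrite mulr_ge0// ltW.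
(* [A] replaces [u] by its largest value; [B] and [C] replace exp(-x) by 1 - x, in the term for a
   recurrence of [i] and in the sum over all types. *)
have A : 0 <= (x * h - u) * (2 * h - 1) by rewrite mulr_ge0//; lra.
have B : 0 <= x * h * (e - (1 - x)) by rewrite mulr_ge0//; lra.
have C : 0 <= h * (7 / 6 + x) * (e - (1 - x)).
  by rewrite mulr_ge0 ?mulr_ge0//; have := x_gt0; lra.
lra.
Qed.

Lemma loss_rv i : bounded_rv (loss p i).
Proof.
have bc k : bounded_rv (fun _ : arr_space M => k : R) by exact: bounded_rv_cst.
have bqZ : bounded_rv (fun w => q i w * \1_Z w) by exact: bounded_rvM.
have b1 := bounded_rvD (bounded_rvM (bc (4 / 3)) bZ) (bq i).
have b2 := bounded_rvD (bounded_rvB b1 (bounded_rvM (bc 2) bqZ)) (bL i 0%N).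
apply: bounded_rvB (bounded_rvB b2 (bc (4 / 3))) _; apply: bounded_rv_sum => j.
exact: bounded_rvB (bounded_rvB (bc _) (bounded_rvM (bc _) (bL j 0%N))) (bL j 1%N).
Qed.

(** The [m] possible first types lose the same amount at least, and m x = 1/2 gives the factor
    h/2. *)
Lemma online_fairness_le : 2^-1 <= h ->
  online_fairness p <=
  \int[P]_w equal_share w - h / 2 * (7 / 12 - 2 / 3 * h - 3 / 2 * x).
Proof.
move=> h2.
have bg : bounded_rv (@equal_share _ _ M) by exact: equal_share_rv.
have bl i : bounded_rv (fun w => \1_(D i) w * loss p i w).
  by apply: bounded_rvM => //; exact: loss_rv.
have bs : bounded_rv (fun w => \sum_i \1_(D i) w * loss p i w).
  exact: bounded_rv_sum.
have bF : bounded_rv (fairness p).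
  by apply: realized_fairness_rv => //; [exact: online_measurable|exact: online_capacity].
apply: (le_trans (le_mean P bF (bounded_rvB bg bs) (fairness_le singleton_groups capacity1 p))).
rewrite (meanB P bg bs) mean_sum// lerB//.
apply: (@le_trans _ _ (\sum_(i : J) x * h * (7 / 12 - 2 / 3 * h - 3 / 2 * x))).
  rewrite sumr_const -/J -[leRHS]mulr_natl -/m.
  have mx : m * x = 2^-1 by rewrite /x mulrCA divff ?mulr1// gt_eqF.
  move: (7 / 12 - _ - _) => Y.
  have -> : m * (x * h * Y) = (m * x) * (h * Y) by ring.
  by rewrite mx mulrCA mulrA.
by apply: ler_sum => i _; exact: mean_loss_ge.
Qed.

End online_algorithm.
End uniform_rates.

(** * Numerical estimates and the symmetric instance *)

Lemma expR_half_bounds (R : realType) :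
  2^-1 <= expR (- 2^-1) :> R /\ expR (- 2^-1) <= 21 / 34 :> R.
Proof.
split; first by have := expR_ge1Dx (- 2^-1 : R); lra.
have e1 : 34 / 21 <= expR 2^-1 :> R.
  (* Raising 1 + 1/16 <= exp(1/16) to the power 8 is precise enough, whereas 1 + 1/2 <= exp(1/2)
     would only give 2/3 in place of 21/34. *)
  apply: (@le_trans _ _ ((17 / 16) ^+ 8)); first lra.
  have -> : 2^-1 = 8%:R * 16^-1 :> R by lra.
  rewrite expRM_natl lerXn2r ?nnegrE ?expR_ge0//.
  by have := expR_ge1Dx (16^-1 : R); lra.
have : expR 2^-1 * expR (- 2^-1) = 1 :> R by rewrite -expRD subrr expR0.
have := expR_ge0 (- 2^-1 : R); nra.
Qed.

(** After bounding [g] and [x], the margin is a concave quadratic in [h], positive at both ends 1/2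
    and 21/34. The product [hh] replaces h^2 by its chord between these ends, and [hx] removes
    [x]. *)
Lemma loss_dominates (R : realFieldType) (g h x : R) :
    2^-1 <= h -> h <= 21 / 34 -> x <= 1 / 400 -> g <= 2^-1 + h ^+ 2 ->
  g - h / 2 * (7 / 12 - 2 / 3 * h - 3 / 2 * x) < 942 / 1000 * g.
Proof.
move=> h_ge h_le x_le g_le.
have hh : 0 <= (h - 2^-1) * (21 / 34 - h) by apply: mulr_ge0; lra.
have hx : 0 <= h * (1 / 400 - x) by apply: mulr_ge0; lra.
lra.
Qed.

Lemma singletons_cover (J : finType) :
  finset.cover [set [set j]%SET | j : J]%SET = [set: J]%SET.
Proof.
apply/setP => j; rewrite inE; apply/bigcupP.
by exists [set j]%SET; rewrite ?set11// imset_f.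
Qed.

Lemma inv_nat_gt0 (R : realType) n (j : 'I_n.+1) : 0 < n.+1%:R^-1 :> R.
Proof. by rewrite invr_gt0. Qed.

(** There are n + 1 types, so that the instance is never empty. *)
Definition symmetric_instance (R : realType) (n : nat) : instance R :=
  @Instance R 'I_n.+1 (fun=> n.+1%:R^-1) (@inv_nat_gt0 R n) 1
    [set [set j]%SET | j : 'I_n.+1]%SET (singletons_cover _).

(** With g the mean equal share, c > 0.942 would give c g <= c times the optimum <= online fairness
    < 0.942 g <= c g. *)
Lemma symmetric_competitive_le (R : realType) (n : nat)
    (M : arrivals (symmetric_instance R n)) (p : online M) (c : R) :
    (199 <= n)%N -> c * optimal_clairvoyant M <= online_fairness p ->
  c <= 942 / 1000.
Proof.
move=> n_ge comp; rewrite leNgt; apply/negP => c_gt.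
(* The sign of [c] allows the optimum to be replaced by its lower bound, the mean equal share. *)
have c0 : 0 <= c by move: c_gt; clear; lra.
have card : #|online_type (symmetric_instance R n)| = n.+1 by exact: card_ord.
have rateE (j : online_type (symmetric_instance R n)) :
    rate j = #|online_type (symmetric_instance R n)|%:R^-1 by rewrite card.
have card_gt0 : (0 < #|online_type (symmetric_instance R n)|)%N by rewrite card.
have [h_ge h_le] := expR_half_bounds R.
have alg_le := @online_fairness_le _ _ M card_gt0 rateE erefl erefl p h_ge.
have g_le := @mean_equal_share_upper _ _ M card_gt0 rateE.
have g_opt := @mean_equal_share_le _ _ M erefl erefl.
have g0 : 0 <= \int[arr_prob M]_w equal_share w.
  by apply: Rintegral_ge0 => w _; exact: equal_share_ge0.
have x_le : 2^-1 / #|online_type (symmetric_instance R n)|%:R <= 1 / 400 :> R.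
  rewrite card ler_pdivrMr; last by rewrite ltr0n.
  have : 200%:R <= n.+1%:R :> R by rewrite ler_nat.
  lra.
move: alg_le g_le g_opt g0 x_le h_ge h_le.
set g := Rintegral _ _ _; set h := expR _; set x := (2^-1 / #|_|%:R)%R.
move=> alg_le g_le g_opt g0 x_le h_ge h_le.
have := loss_dominates h_ge h_le x_le g_le; rewrite ltNge => /negP; apply.
apply: (le_trans _ alg_le); apply: (le_trans _ comp).
apply: (@le_trans _ _ (c * g)); first by apply: (ler_wpM2r g0); exact: ltW.
exact: ler_wpM2l g_opt.
Qed.

Theorem theorem7 (R : realType) (M : forall I : instance R, arrivals I)
    (alg : forall I : instance R, online (M I)) (c : R) :
  competitive alg (@unit_instance R) c -> c <= 942 / 1000.
Proof.
(* Index 199 stands for 200 types, for which [x] is exactly 1/400. *)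
move=> comp; apply: (symmetric_competitive_le (leqnn 199)); apply: comp.
split; first by [].
by rewrite sumr_const card_ord -[LHS]mulr_natl divff// pnatr_eq0.
Qed.
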